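(* Suppose that for $a\in\{0,1\}$, $\eta_a(X)$ has a probability density function when $X\sim\mathbb P_{X\mid A=a}$. For any $\delta>0$, the group-wise thresholding rules given for all $x,a$ by $$f^\star_{\mathrm{DD},\delta}(x,a)=I\Big(\eta_a(x)>\tfrac12+\tfrac{(2a-1)t_{\mathrm{DD}}(\delta)}{2p_a}\Big),\qquad f^\star_{\mathrm{DO},\delta}(x,a)=I\Big(\eta_a(x)>\tfrac{p_{a,1}}{2p_{a,1}-(2a-1)t_{\mathrm{DO}}(\delta)}\Big),$$ $$f^\star_{\mathrm{PD},\delta}(x,a)=I\Big(\eta_a(x)>\tfrac{p_{a,0}+(2a-1)t_{\mathrm{PD}}(\delta)}{2p_{a,0}+(2a-1)t_{\mathrm{PD}}(\delta)}\Big),$$ with $$t_{\mathrm{DD}}(\delta)=\operatorname*{argmin}_{t\in[-\min(p_1,p_0),\min(p_1,p_0)]}\Big\{|t|:\Big|\sum_{a\in\{0,1\}}(2a-1)\int_{\mathcal X} I\Big(\eta_a(x)>\tfrac12+\tfrac{(2a-1)t}{2p_a}\Big)d\mathbb P_{X\mid A=a}(x)\Big|\le\delta\Big\},$$ $$t_{\mathrm{DO}}(\delta)=\operatorname*{argmin}_{t\in[-p_{0,1},p_{1,1}]}\Big\{|t|:\Big|\sum_{a\in\{0,1\}}(2a-1)\int_{\mathcal X} I\Big(\eta_a(x)>\tfrac{p_{a,1}}{2p_{a,1}-(2a-1)t}\Big)d\mathbb P_{X\mid A=a,Y=1}(x)\Big|\le\delta\Big\},$$ $$t_{\mathrm{PD}}(\delta)=\operatorname*{argmin}_{t\in[-p_{1,0},p_{0,0}]}\Big\{|t|:\Big|\sum_{a\in\{0,1\}}(2a-1)\int_{\mathcal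 X} I\Big(\eta_a(x)>\tfrac{p_{a,0}+(2a-1)t}{2p_{a,0}+(2a-1)t}\Big)d\mathbb P_{X\mid A=a,Y=0}(x)\Big|\le\delta\Big\},$$ are $\delta$-fair Bayes-optimal classifiers under $\mathrm{DD}$, $\mathrm{DO}$ and $\mathrm{PD}$, respectively.
   Context: Let $(X,A,Y)\sim\mathbb P$ be a random triple with values in $\mathcal X\times\{0,1\}\times\{0,1\}$, with $p_a=\mathbb P(A=a)$, $p_{a,y}=\mathbb P(A=a,Y=y)>0$, $\eta_a(x)=\mathbb P(Y=1\mid A=a,X=x)$; $\mathbb P_{X\mid A=a}$ and $\mathbb P_{X\mid A=a,Y=y}$ are the conditional laws of $X$. $I(\cdot)$ is the indicator function. A (randomized) classifier is a measurable $f:\mathcal X\times\{0,1\}\to[0,1]$; $\mathcal F$ is the set of all of them. Its prediction satisfies $\widehat Y_f\mid X=x,A=a\sim\mathrm{Bernoulli}(f(x,a))$, conditionally independent of $Y$ given $(X,A)$. The misclassification error is $R(f)=\mathbb P(Y\ne\widehat Y_f)$. The disparity measures are $\mathrm{DD}(f)=\mathbb P(\widehat Y_f=1\mid A=1)-\mathbb P(\widehat Y_f=1\mid A=0)$, $\mathrm{DO}(f)=\mathbb P(\widehat Y_f=1\mid A=1,Y=1)-\mathbb P(\widehat Y_f=1\mid A=0,Y=1)$, $\mathrm{PD}(f)=\mathbb P(\widehat Y_f=1\mid A=1,Y=0)-\mathbb P(\widehat Y_f=1\mid A=0,Y=0)$. For $\mathrm{Dis}\in\{\mathrm{DD},\mathrm{DO},\mathrm{PD}\}$,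 a $\delta$-fair Bayes-optimal classifier under $\mathrm{Dis}$ is any element of $\operatorname{argmin}_{f\in\mathcal F}\{R(f):|\mathrm{Dis}(f)|\le\delta\}$. *)

(* Defs.v *)
From HB Require Import structures.
From mathcomp Require Import all_boot all_order all_algebra.
From mathcomp Require Import all_classical all_reals all_analysis.
From mathcomp Require Import measurable_realfun.

Set Implicit Arguments.
Unset Strict Implicit.
Unset Printing Implicit Defensive.

Import Order.TTheory GRing.Theory Num.Theory.
Import numFieldNormedType.Exports.

Local Open Scope classical_set_scope.
Local Open Scope ring_scope.

Definition argmin (T : Type) (R : realType) (S : set T) (obj : T -> R) : set T :=
  [set x | S x /\ forall y, S y -> obj x <= obj y].

Definition has_pdf (R : realType) (mu : set R -> \bar R) : Prop :=
  exists g : R -> R,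
    [/\ measurable_fun setT g, forall r, 0 <= g r &
        forall B, measurable B ->
          mu B = (\int[lebesgue_measure]_(r in B) (g r)%:E)%E].

(* P( . | F).  The normalization is P itself in the irrelevant case P F = 0. *)
Definition conditioned d (T : measurableType d) (R : realType)
    (P : probability T R) (F : set T) (mF : measurable F) : probability T R :=
  mnormalize (mrestr P mF) P.

Section classifiers.
Context d (X : measurableType d) (R : realType).

Record classifier := Classifier {
  classifier_fun :> X * bool -> R ;
  measurable_classifier : measurable_fun setT classifier_fun ;
  classifier01 : forall z, 0 <= classifier_fun z <= 1 }.

Lemma measurable_threshold (eta : bool -> {mfun X >-> R}) (c : bool -> R) :
  measurable_fun setT (fun z : X * bool => (c z.2 < eta z.2 z.1)%R%:R : R).
Proof.
have -> : (fun z : X * bool => (c z.2 < eta z.2 z.1)%R%:R : R) =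
  (fun z => if z.2 then (c true < eta true z.1)%R%:R
            else (c false < eta false z.1)%R%:R).
  by apply/funext => -[x []].
have mb a : measurable_fun setT
    (fun z : X * bool => (c a < eta a z.1)%R%:R : R).
  have -> : (fun z : X * bool => (c a < eta a z.1)%R%:R : R) =
    (fun z => if c a < eta a z.1 then 1 else 0).
    by apply/funext => z; case: ifPn.
  apply: measurable_fun_ifT => //.
  by apply: measurable_fun_ltr => //; exact: measurableT_comp.
by apply: measurable_fun_ifT => //; exact: mb.
Qed.

Lemma threshold01 (eta : bool -> {mfun X >-> R}) (c : bool -> R)
    (z : X * bool) : 0 <= ((c z.2 < eta z.2 z.1)%R%:R : R) <= 1.
Proof. by case: (_ < _); rewrite lexx ler01. Qed.

Definition threshold_rule (eta : bool -> {mfun X >-> R}) (c : bool -> R) :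
    classifier :=
  Classifier (measurable_threshold eta c) (threshold01 eta c).

End classifiers.

Section triple.
Context d (X : measurableType d) (R : realType).

Definition ev_A (a : bool) : set (X * bool * bool)%type := [set z | z.1.2 = a].
Definition ev_Y (y : bool) : set (X * bool * bool)%type := [set z | z.2 = y].

Lemma measurable_ev_A a : measurable (ev_A a).
Proof.
rewrite (_ : ev_A a = (snd \o fst) @^-1` [set a])//.
rewrite -[X in measurable X]setTI.
have : measurable_fun setT (snd \o fst : (X * bool * bool)%type -> bool).
  exact: measurableT_comp.
exact.
Qed.

Lemma measurable_ev_Y y : measurable (ev_Y y).
Proof.
rewrite (_ : ev_Y y = snd @^-1` [set y])// -[X in measurable X]setTI.
have : measurable_fun setT (snd : (X * bool * bool)%type -> bool) by [].
exact.
Qed.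

Lemma measurable_ev_AY a y : measurable (ev_A a `&` ev_Y y).
Proof.
by apply: measurableI; [exact: measurable_ev_A|exact: measurable_ev_Y].
Qed.

Definition feature (z : X * bool * bool) : X := z.1.1.

Lemma measurable_feature : measurable_fun setT feature.
Proof. exact: measurableT_comp. Qed.

HB.instance Definition _ :=
  isMeasurableFun.Build _ _ _ _ feature measurable_feature.

Variable P : probability (X * bool * bool)%type R.

Definition pA (a : bool) : R := fine (P (ev_A a)).
Definition pAY (a y : bool) : R := fine (P (ev_A a `&` ev_Y y)).

Definition lawX_A (a : bool) : probability X R :=
  distribution (conditioned P (measurable_ev_A a)) feature.

Definition lawX_AY (a y : bool) : probability X R :=
  distribution (conditioned P (measurable_ev_AY a y)) feature.

(* eta a is a [0, 1]-valued version of x |-> P(Y = 1 | A = a, X = x), i.e. of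
   the conditional probability of Y = 1 given X under P( . | A = a). *)
Definition is_regression_function (eta : bool -> {mfun X >-> R}) : Prop :=
  forall a,
    (forall x, 0 <= eta a x <= 1) /\
    (forall B, measurable B ->
       conditioned P (measurable_ev_A a) (feature @^-1` B `&` ev_Y true) =
       (\int[lawX_A a]_(x in B) (eta a x)%:E)%E).

End triple.

Section prediction.
Context d (X : measurableType d) (R : realType).
Variables (P : probability (X * bool * bool)%type R) (f : classifier X R).

Lemma measurable_prediction :
  measurable_fun setT (fun w : unit * (X * bool * bool) =>
    bernoulli_prob (f w.2.1) : pprobability bool R).
Proof.
apply: (measurableT_comp measurable_bernoulli_prob).
apply: (measurableT_comp (measurable_classifier f)).
exact: measurableT_comp.
Qed.

(* The law of (X, A, Y, Yhat_f): the law P of (X, A, Y) extended by a last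
   coordinate drawn from Bernoulli(f(X, A)). The drawing kernel does not look at
   Y, which makes Yhat_f independent of Y given (X, A). The type unit only fills
   the parameter slot of kernel products. *)
Definition prediction_law : set (X * bool * bool * bool)%type -> \bar R :=
  mkproduct
    (kprobability (measurable_cst (P : pprobability _ R) : measurable_fun
      [set: unit] _))
    (kprobability measurable_prediction) tt.

Let prediction_law0 : prediction_law set0 = 0%E.
Proof. exact: measure0. Qed.

Let prediction_law_ge0 S : (0 <= prediction_law S)%E.
Proof. exact: measure_ge0. Qed.

Let prediction_law_sigma_additive : semi_sigma_additive prediction_law.
Proof. exact: measure_semi_sigma_additive. Qed.

HB.instance Definition _ := isMeasure.Build _ _ _ prediction_law
  prediction_law0 prediction_law_ge0 prediction_law_sigma_additive.

Lemma prediction_lawE S : measurable S ->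
  prediction_law S = (\int[P]_z bernoulli_prob (f z.1) (xsection S z))%E.
Proof.
move=> mS; rewrite /prediction_law /mkproduct /= /kproduct.
by apply: eq_integral => z _; rewrite kernel.intker_indicE.
Qed.

Lemma prediction_law_setT : prediction_law setT = 1%E.
Proof.
rewrite prediction_lawE// (eq_integral (cst 1%E)).
  by rewrite integral_cst// mul1e; exact: probability_setT.
move=> z _; rewrite (_ : xsection setT z = setT) ?probability_setT//.
by apply/seteqP; split => // y _; rewrite /xsection /= inE.
Qed.

HB.instance Definition _ :=
  Measure_isProbability.Build _ _ _ prediction_law prediction_law_setT.

End prediction.

Section fairness.
Context d (X : measurableType d) (R : realType).
Variable P : probability (X * bool * bool)%type R.

Definition risk (f : classifier X R) : R :=
  fine (prediction_law P f [set w | w.1.2 <> w.2]).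

Lemma measurable_fst_preimage (F : set (X * bool * bool)%type) : measurable F ->
  measurable (fst @^-1` F : set (X * bool * bool * bool)%type).
Proof.
move=> mF; rewrite -[X in measurable X]setTI.
have : measurable_fun setT (fst : (X * bool * bool * bool)%type -> (X * bool * bool)%type).
  by [].
exact.
Qed.

(* P(Yhat_f = 1 | F) for an event F about (X, A, Y). *)
Definition positive_rate (f : classifier X R) (F : set (X * bool * bool)%type)
    (mF : measurable F) : R :=
  fine (conditioned (prediction_law P f) (measurable_fst_preimage mF)
          [set w | w.2 = true]).

Definition DD (f : classifier X R) : R :=
  positive_rate f (measurable_ev_A true) -
  positive_rate f (measurable_ev_A false).

Definition DO (f : classifier X R) : R :=
  positive_rate f (measurable_ev_AY true true) -
  positive_rate f (measurable_ev_AY false true).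

Definition PD (f : classifier X R) : R :=
  positive_rate f (measurable_ev_AY true false) -
  positive_rate f (measurable_ev_AY false false).

Definition fair_bayes_optimal (Dis : classifier X R -> R) (delta : R) :
    set (classifier X R) :=
  argmin [set f | `|Dis f| <= delta] risk.

End fairness.

Definition sgnA (R : realType) (a : bool) : R := 2 * a%:R - 1.

Section thresholds.
Context d (X : measurableType d) (R : realType).
Variable P : probability (X * bool * bool)%type R.

Definition thresholdDD (t : R) (a : bool) : R :=
  1 / 2 + sgnA R a * t / (2 * pA P a).

Definition thresholdDO (t : R) (a : bool) : R :=
  pAY P a true / (2 * pAY P a true - sgnA R a * t).

Definition thresholdPD (t : R) (a : bool) : R :=
  (pAY P a false + sgnA R a * t) / (2 * pAY P a false + sgnA R a * t).

End thresholds.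

(* Main.v *)
(** The rates and the risk of [f] are integrals of [f (., a)] against the law of
    [X] given [A = a], with weights that are functions of [eta a].  For a
    multiplier [t], the Lagrangian [risk f + t * Dis f] is therefore minimized
    pointwise, and its minimizer is the group-wise threshold rule of parameter
    [t].  The disparity [D t] of that rule is nonincreasing, and it is continuous
    because [eta a] has no atoms; moreover it is nonpositive at the right end of
    the interval of parameters and nonnegative at the left end.  Hence the
    parameter [t0] of least absolute value with [`|D t0| <= delta] exists, is
    unique, and satisfies the complementary slackness
    [t0 * D t0 = `|t0| * delta].  Weak duality then gives optimality. *)

Require Import Defs.
From HB Require Import structures.
From mathcomp Require Import all_boot all_order all_algebra.
From mathcomp Require Import all_classical all_reals all_analysis.
From mathcomp Require Import measurable_realfun ring lra.

Set Implicit Arguments.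
Unset Strict Implicit.
Unset Printing Implicit Defensive.

Import Order.TTheory GRing.Theory Num.Theory.
Import numFieldNormedType.Exports.

Local Open Scope classical_set_scope.
Local Open Scope ring_scope.

(** * Least-norm feasible parameter of a continuous monotone function *)

(** The feasible set is nonempty by the intermediate value theorem, compact by continuity and convex
    by monotonicity. Two minimizers of opposite signs would enclose 0, which would then be feasible
    and better. If [t0] is not 0, then 0 is infeasible, and an intermediate value between 0 and [t0]
    shows that the constraint is tight at [t0], with the sign of [t0]. *)
Lemma argmin_norm_slackness (R : realType) (D : R -> R) (lo hi delta : R) :
  lo <= 0 <= hi -> 0 < delta ->
  {within `[lo, hi], continuous D} ->
  {in `[lo, hi] &, forall s t, s <= t -> D t <= D s} ->
  D hi <= 0 <= D lo ->
  exists2 t0 : R,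
    argmin [set t | t \in `[lo, hi] /\ `|D t| <= delta] (fun t => `|t|) =
      [set t0] &
    t0 * D t0 = `|t0| * delta.
Proof.
move=> /andP[lo0 hi0] delta0 cD dD /andP[Dhi Dlo].
set S := [set t | _].
have lohi := le_trans lo0 hi0.
have in0 : 0 \in `[lo, hi] by rewrite in_itv/= lo0 hi0.
have subitv a b : a \in `[lo, hi] -> b \in `[lo, hi] ->
    (`[a, b] : set R) `<=` `[lo, hi].
  rewrite !in_itv/= => /andP[? _] /andP[_ ?] x/=; rewrite !in_itv/=.
  by move=> /andP[? ?]; apply/andP; split; lra.
have ivt a b v : a \in `[lo, hi] -> b \in `[lo, hi] -> a <= b ->
    D b <= v <= D a -> exists2 c, c \in `[a, b] & D c = v.
  move=> ia ib ab /andP[bv va]; apply: IVT => //.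
    exact: continuous_subspaceW (subitv _ _ ia ib) cD.
  by rewrite ge_min le_max bv va orbT.
(* If 0 is infeasible, moving towards the end where the sign of [D] is opposite to that of [D 0]
   meets the value [delta] or [- delta]. *)
have S0 : S !=set0.
  have [D0|D0] := lerP `|D 0| delta; first by exists 0.
  have := D0; rewrite lter_normr => /orP[D0d|D0d].
    have [||c] := ivt 0 hi delta in0 _ hi0.
    - by rewrite in_itv/= lexx andbT.
    - by apply/andP; split; lra.
    move=> + Dc; rewrite in_itv/= => /andP[? ?]; exists c; split.
      by rewrite in_itv/=; apply/andP; split; lra.
    by rewrite Dc gtr0_norm.
  have [||c] := ivt lo 0 (- delta) _ in0 lo0.
  - by rewrite in_itv/= lexx.
  - by apply/andP; split; lra.
  move=> + Dc; rewrite in_itv/= => /andP[? ?]; exists c; split.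
    by rewrite in_itv/=; apply/andP; split; lra.
  by rewrite Dc normrN gtr0_norm.
have cS : compact S.
  (* [D] is continuous only within the interval, so closedness is first obtained in the subspace
     topology and then transferred through a closed set [V] of the line. *)
  have : closed (D @^-1` [set y | `|y| <= delta] : set (subspace `[lo, hi])).
    move/continuous_closedP : cD; apply.
    have -> : [set y : R | `|y| <= delta] = Num.norm @^-1` [set y | y <= delta].
      by [].
    by apply: preimage_closed (@closed_le _ _) => x _; exact: norm_continuous.
  move=> /closed_subspaceP[V cV VE].
  have -> : S = `[lo, hi] `&` V.
    rewrite setIC VE; apply/seteqP; split => [t [? ?]|t [? ?]]; by split.
  apply: subclosed_compact; [|exact: (@segment_compact _ lo hi)|exact: subIsetl].
  by apply: closedI => //; exact: itv_closed.
have [|t0 t0S t0min] := @compact_EVT_min _ _ (fun t : R => `|t|) S S0 cS.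
  by apply: continuous_subspaceT => x; exact: norm_continuous.
move: t0S; rewrite inE => -[t0I Dt0].
have {}t0min t : S t -> `|t0| <= `|t| by move=> St; apply: t0min; rewrite inE.
have Sle a b c : S a -> S c -> a <= b <= c -> S b.
  move=> [ia Da] [ic Dc] /andP[ab bc].
  have ib : b \in `[lo, hi].
    by move: ia ic; rewrite !in_itv/= => /andP[? ?] /andP[? ?]; apply/andP; split; lra.
  split=> //; have := dD _ _ ia ib ab; have := dD _ _ ib ic bc.
  by move: Da Dc; rewrite !ler_norml => /andP[? ?] /andP[? ?] *; apply/andP; split; lra.
exists t0.
  apply/seteqP; split => [t [St tmin]|_ ->]; last by split.
  have {tmin} : `|t| = `|t0|.
    by apply/le_anti; rewrite t0min// andbT; exact: (tmin t0).
  (* Only the two cases of opposite signs survive [lra]; in both, 0 lies between [t] and [t0]. *)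
  move=> tt0; have /= := tt0; case: (ltrgt0P t); case: (ltrgt0P t0) => *; try lra.
    have S0' : S 0 by apply: (Sle t0 _ t); [by split|by []|apply/andP; split; lra].
    by have := t0min _ S0'; rewrite normr0 normr_le0 => /eqP; lra.
  have S0' : S 0 by apply: (Sle t _ t0); [by []|by split|apply/andP; split; lra].
  by have := t0min _ S0'; rewrite normr0 normr_le0 => /eqP; lra.
have nS0 : t0 != 0 -> ~ S 0.
  move=> t00 S0'; have := t0min _ S0'; rewrite normr0 normr_le0 => /eqP E.
  by rewrite E eqxx in t00.
move: (Dt0); rewrite ler_norml => /andP[Dt1 Dt2].
have Spt t : t \in `[lo, hi] -> `|D t| = delta -> S t by move=> ? E; split; rewrite ?E.
case: (ltrgt0P t0) => [tp|tn|->]; last by rewrite !mul0r.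
- have D00 : delta <= D 0.
    rewrite leNgt; apply/negP => Dlt; apply: nS0; first by rewrite gt_eqF.
    split=> //; rewrite ler_norml (ltW Dlt) andbT (le_trans Dt1)//.
    exact: (dD _ _ in0 t0I (ltW tp)).
  (* The point [c] where [D] equals [delta] is feasible and no farther from 0 than [t0], so it is
     [t0] itself. *)
  have [|c] := ivt 0 t0 delta in0 t0I (ltW tp); first by rewrite Dt2.
  move=> cI Dc; move: (cI); rewrite in_itv/= => /andP[c0 ct].
  have /t0min : S c.
    by apply: Spt; [exact: (subitv _ _ in0 t0I)|rewrite Dc gtr0_norm].
  rewrite (gtr0_norm tp) (ger0_norm c0) => tc.
  have tE : t0 = c by apply/le_anti; rewrite tc ct.
  by rewrite {2}tE Dc.
- have D00 : D 0 <= - delta.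
    rewrite leNgt; apply/negP => Dlt; apply: nS0; first by rewrite lt_eqF.
    split=> //; rewrite ler_norml (ltW Dlt)/= (le_trans _ Dt2)//.
    exact: (dD _ _ t0I in0 (ltW tn)).
  have [|c] := ivt t0 0 (- delta) t0I in0 (ltW tn); first by rewrite Dt1 D00.
  move=> cI Dc; move: (cI); rewrite in_itv/= => /andP[c0 ct].
  have /t0min : S c.
    by apply: Spt; [exact: (subitv _ _ t0I in0)|rewrite Dc normrN gtr0_norm].
  rewrite (ltr0_norm tn) (ler0_norm ct) => tc.
  have tE : t0 = c by apply/le_anti; rewrite c0 -lerN2 tc.
  by rewrite {2}tE Dc mulrN mulNr.
Qed.

(** * Bounded integrands and densities *)

Lemma bounded_integrable d (T : measurableType d) (R : realType)
    (mu : probability T R) (f : T -> R) (M : R) :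
  measurable_fun setT f -> (forall x, `|f x| <= M) ->
  mu.-integrable setT (EFin \o f).
Proof.
move=> mf fM; apply: measurable_bounded_integrable => //.
  by rewrite -ge0_fin_numE// fin_num_measure.
exists M; split; first exact: num_real.
by move=> y My x _ /=; rewrite (le_trans (fM x))// ltW.
Qed.

(** The formula for [nu] gives absolute continuity, and [g] agrees almost everywhere with the
    Radon-Nikodym derivative, since both have the same integral over every measurable set. *)
Lemma Rintegral_density d (T : measurableType d) (R : realType)
    (nu mu : probability T R) (g h : T -> R) :
  measurable_fun setT g -> (forall x, 0 <= g x) ->
  (forall B, measurable B -> nu B = (\int[mu]_(x in B) (g x)%:E)%E) ->
  measurable_fun setT h -> (forall x, 0 <= h x) ->
  \int[nu]_x h x = \int[mu]_x (h x * g x).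
Proof.
move=> mg g0 nuE mh h0.
have mgE : measurable_fun setT (fun x => (g x)%:E) by exact/measurable_EFinP.
have mhE : measurable_fun setT (fun x => (h x)%:E) by exact/measurable_EFinP.
have numu : nu `<< mu.
  apply/null_content_dominatesP => B mB muB0; rewrite nuE//.
  rewrite (eq_integral (fun x => `|(g x)%:E|%E)); last first.
    by move=> x _; rewrite gee0_abs ?lee_fin.
  by rewrite integral_abs_eq0//; exact: measurable_funTS.
pose rn := Radon_Nikodym_SigmaFinite.f nu mu.
have irn : mu.-integrable setT rn := Radon_Nikodym_SigmaFinite.f_integrable numu.
have rnE : ae_eq mu setT rn (EFin \o g).
  apply: integral_ae_eq => // E _ mE.
  by rewrite -nuE//; exact/esym/(Radon_Nikodym_SigmaFinite.f_integral numu).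
rewrite /Rintegral; congr fine.
rewrite -(Radon_Nikodym_SigmaFinite.change_of_variables numu)//.
apply: ae_eq_integral => //.
- by apply: emeasurable_funM => //; exact: measurable_int irn.
- by apply/measurable_EFinP/measurable_funM.
- exact: (ae_eqe_mul2l (EFin \o h) rnE).
Qed.

(** * Integrals against conditional laws *)

Section laws.
Context d (T : measurableType d) (R : realType) (P : probability T R).

(** Positivity of [P F] excludes the default branch of [mnormalize]. *)
Lemma conditionedE (F B : set T) (mF : measurable F) : 0 < fine (P F) ->
  conditioned P mF B = (P (B `&` F) * (fine (P F))^-1%:E)%E.
Proof.
move=> F0; have PF : P F = (fine (P F))%:E by rewrite fineK ?fin_num_measure.
rewrite /conditioned /= /mnormalize /= /mrestr setTI ifF//.
by rewrite PF; apply/negbTE; rewrite negb_or eqe gt_eqF.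
Qed.

(** The conditioned measure has density [\1_F] divided by [P F] with respect to [P]. *)
Lemma Rintegral_conditioned (F : set T) (mF : measurable F) (h : T -> R) :
  0 < fine (P F) -> measurable_fun setT h -> (forall x, 0 <= h x <= 1) ->
  \int[P]_x (h x * \1_F x) = fine (P F) * \int[conditioned P mF]_x h x.
Proof.
move=> F0 mh h01.
have mhF : measurable_fun setT (fun x => h x * \1_F x).
  by apply: measurable_funM.
rewrite [in RHS](@Rintegral_density _ _ _ _ P (fun x => (fine (P F))^-1 * \1_F x))//.
- under [in RHS]eq_Rintegral do rewrite mulrCA.
  rewrite [in RHS]RintegralZl//; last first.
    apply: (@bounded_integrable _ _ _ _ _ 1) => // x.
    have /andP[? ?] := h01 x; rewrite indicE.
    by case: (x \in F); rewrite ?mulr1 ?mulr0 ?normr0// ger0_norm.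
  by rewrite mulrA divff ?mul1r// gt_eqF.
- by apply: measurable_funM.
- by move=> x; rewrite mulr_ge0// invr_ge0 ltW.
- move=> B mB; rewrite conditionedE//.
  under eq_integral do rewrite EFinM.
  rewrite integralZl//; last first.
    apply: (@integrableS _ _ _ _ setT) => //.
    apply: (@bounded_integrable _ _ _ _ _ 1) => // x.
    by rewrite indicE; case: (x \in F); rewrite ?normr1 ?normr0.
  by rewrite integral_indic// setIC muleC.
- by move=> x; have /andP[] := h01 x.
Qed.

End laws.

(** * Rates and risk as integrals over the feature space *)

Section feature_law.
Context d (X : measurableType d) (R : realType).
Variable P : probability (X * bool * bool)%type R.
Implicit Types (f : classifier X R) (F : set (X * bool * bool)%type).

Lemma Rintegral_feature_law F (mF : measurable F) (h : X -> R) :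
  0 < fine (P F) -> measurable_fun setT h -> (forall x, 0 <= h x <= 1) ->
  \int[P]_z (h (feature z) * \1_F z) =
  fine (P F) * \int[distribution (conditioned P mF) (@feature _ X)]_x h x.
Proof.
move=> F0 mh h01; rewrite (@Rintegral_conditioned _ _ _ _ _ mF (h \o @feature _ X))//.
- congr *%R; rewrite /Rintegral ge0_integral_distribution//.
    exact/measurable_EFinP.
  by move=> x; rewrite lee_fin; have /andP[] := h01 x.
- by apply: measurableT_comp => //; exact: measurable_feature.
- by move=> x; exact: h01.
Qed.

Lemma measurable_classifier_group f a : measurable_fun setT (fun x => f (x, a)).
Proof. by apply: measurableT_comp => //; exact: measurable_classifier. Qed.

Lemma classifier_group01 f a x : 0 <= f (x, a) <= 1.
Proof. exact: classifier01. Qed.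

(** A Bernoulli law is a mixture of two Dirac masses, so every event about the prediction becomes an
    integral under [P]. *)
Lemma prediction_law_integral f S : measurable S ->
  prediction_law P f S =
  (\int[P]_z (f z.1 * \1_S (z, true) + (1 - f z.1) * \1_S (z, false))%:E)%E.
Proof.
move=> mS; rewrite prediction_lawE//; apply: eq_integral => z _.
rewrite bernoulli_probE; last exact: classifier01.
have xS b : \d_b (xsection S z) = (\1_S (z, b))%:E :> \bar R.
  by rewrite diracE indicE mem_xsection.
by rewrite !xS.
Qed.

(** Inclusion in [ev_A a] freezes the group argument of [f]. Keeping [F] general covers conditioning
    on the group alone as well as on group and label. *)
Lemma positive_rateE f F (mF : measurable F) a :
  0 < fine (P F) -> F `<=` @ev_A _ X a ->
  positive_rate P f mF =
  \int[distribution (conditioned P mF) (@feature _ X)]_x f (x, a).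
Proof.
move=> F0 Fa; have mF' := measurable_fst_preimage mF.
have inF z b : ((z, b) \in (fst @^-1` F : set (X * bool * bool * bool)%type)) =
    (z \in F).
  by apply/idP/idP; rewrite !inE.
(* The first marginal of the extended law is [P], because the weights [f] and [1 - f] sum to 1. *)
have QF : prediction_law P f (fst @^-1` F) = P F.
  rewrite prediction_law_integral// -[in RHS](setIT F) -integral_indic//.
  apply: eq_integral => z _; rewrite !indicE !inF; congr EFin.
  by rewrite -mulrDl addrC subrK mul1r.
have mS : measurable [set w : X * bool * bool * bool | w.2 = true].
  rewrite (_ : [set w | _] = snd @^-1` [set true])// -[X in measurable X]setTI.
  have : measurable_fun setT (snd : X * bool * bool * bool -> bool) by [].
  exact.
have Q0 : 0 < fine (prediction_law P f (fst @^-1` F)) by rewrite QF.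
rewrite /positive_rate (conditionedE _ _ Q0) /= QF fineM ?fin_num_measure//; last first.
  exact: measurableI.
apply: (@mulfI _ (fine (P F))); first by rewrite gt_eqF.
rewrite mulrCA mulfV ?gt_eqF// mulr1 -Rintegral_feature_law//; last 2 first.
- exact: measurable_classifier_group.
- exact: classifier_group01.
rewrite prediction_law_integral; last exact: measurableI.
congr fine; apply: eq_integral => z _; congr EFin.
rewrite !indicE !in_setI !inF.
rewrite mem_set// [(z, false) \in _]memNset//.
rewrite /= mulr0 addr0; have [zF|] := boolP (z \in F); last by rewrite !mulr0.
by have <- : z.1.2 = a; [apply: Fa; rewrite inE in zF|case: z {zF} => -[]].
Qed.

Lemma measurable_label_mismatch :
  measurable [set w : X * bool * bool * bool | w.1.2 <> w.2].
Proof.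
pose m (w : X * bool * bool * bool) := if w.2 then ~~ w.1.2 else w.1.2.
have mm : measurable_fun setT m.
  have mY : measurable_fun setT (fun w : X * bool * bool * bool => w.1.2).
    exact: measurableT_comp.
  by apply: measurable_fun_ifT => //; exact: measurable_neg.
rewrite (_ : [set w | _] = m @^-1` [set true]).
  by rewrite -[X in measurable X]setTI; exact: mm.
by apply/seteqP; split => -[[[? ?] []] []].
Qed.

(** The mismatch event is split over the four cells of group and label; a cell with label [true]
    errs with probability [1 - f], one with label [false] with probability [f]. *)
Lemma riskE f :
  (forall a y, 0 < pAY P a y) ->
  risk P f = \sum_(a : bool) \sum_(y : bool)
    pAY P a y * \int[lawX_AY P a y]_x (if y then 1 - f (x, a) else f (x, a)).
Proof.
move=> hp; pose k a (y : bool) x := if y then 1 - f (x, a) else f (x, a).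
have mk a y : measurable_fun setT (k a y).
  case: y; last exact: measurable_classifier_group.
  by apply: measurable_funB => //; exact: measurable_classifier_group.
have k01 a y x : 0 <= k a y x <= 1.
  by have := classifier_group01 f a x; rewrite /k; case: y => /andP[? ?]; apply/andP; split; lra.
pose K a y z : R := k a y (feature z) * \1_(ev_A a `&` ev_Y y) z.
have intK a y : P.-integrable setT (EFin \o K a y).
  apply: (@bounded_integrable _ _ _ _ _ 1) => [|z].
    apply: measurable_funM.
      by apply: measurableT_comp => //; exact: measurable_feature.
    by apply: measurable_indic; exact: measurable_ev_AY.
  have /andP[? ?] := k01 a y (feature z).
  rewrite /K indicE; case: (_ \in _); rewrite ?mulr1 ?mulr0 ?normr0//.
  by rewrite ger0_norm.
rewrite !big_bool /=.
have lawK a y : pAY P a y * \int[lawX_AY P a y]_x k a y x = \int[P]_z K a y z.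
  rewrite (Rintegral_feature_law (measurable_ev_AY a y) _ (mk a y) (k01 a y))//.
  exact: hp.
rewrite (lawK true true) (lawK true false) (lawK false true) (lawK false false).
have intD (k1 k2 : X * bool * bool -> R) : P.-integrable setT (EFin \o k1) ->
    P.-integrable setT (EFin \o k2) ->
    P.-integrable setT (EFin \o (fun z => k1 z + k2 z)).
  by move=> i1 i2; have := integrableD measurableT i1 i2.
rewrite -!RintegralD//; [|exact: intD..].
rewrite /risk prediction_law_integral; last exact: measurable_label_mismatch.
congr fine; apply: eq_integral => z _; congr EFin.
rewrite /K /k !indicE !in_setI.
have mE b : ((z, b) \in [set w : X * bool * bool * bool | w.1.2 <> w.2]) =
    (z.2 != b).
  by apply/idP/idP; rewrite inE => /eqP.
have aE b : (z \in @ev_A _ X b) = (z.1.2 == b).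
  by apply/idP/idP; rewrite inE => /eqP.
have yE b : (z \in @ev_Y _ X b) = (z.2 == b).
  by apply/idP/idP; rewrite inE => /eqP.
rewrite !mE !aE !yE /feature.
by case: z {mE aE yE} => -[x []] [] /=; ring.
Qed.

Section regression.
Variable eta : bool -> {mfun X >-> R}.
Hypothesis heta : is_regression_function P eta.
Hypothesis hp : forall a y, 0 < pAY P a y.

Lemma pA_gt0 a : 0 < pA P a.
Proof.
have mA := @measurable_ev_A _ X a; have mAY := @measurable_ev_AY _ X a true.
apply: lt_le_trans (hp a true) _; apply: fine_le; rewrite ?fin_num_measure//.
by apply: le_measure; rewrite ?inE//; exact: subIsetl.
Qed.

(** This is Bayes' rule: conditioning further on the label reweights the law of the features in the
    group by the ratio of P(Y = y | A = a, X = x) to P(Y = y | A = a). It brings all integrals in a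
    group to one reference law. *)
Lemma lawX_AY_density a y (h : X -> R) :
  measurable_fun setT h -> (forall x, 0 <= h x <= 1) ->
  \int[lawX_AY P a y]_x h x =
  \int[lawX_A P a]_x
    (h x * (pA P a / pAY P a y * (if y then eta a x else 1 - eta a x))).
Proof.
move=> mh h01; have [eta01 etaE] := heta a.
have p0 := pA_gt0 a; have q0 := hp a y.
pose g x := if y then eta a x else 1 - eta a x.
have mg : measurable_fun setT g.
  by rewrite /g; case: (y) => //; exact: measurable_funB.
have g01 x : 0 <= g x <= 1.
  by have := eta01 x; rewrite /g; case: (y) => /andP[? ?]; apply/andP; split; lra.
have ig : (lawX_A P a).-integrable setT (EFin \o g).
  apply: (@bounded_integrable _ _ _ _ _ 1) => // x.
  by have /andP[? ?] := g01 x; rewrite ger0_norm.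
apply: (@Rintegral_density _ _ _ _ _ (fun x => pA P a / pAY P a y * g x)) => //.
- exact: measurable_funM.
- move=> x; have /andP[? _] := g01 x.
  by rewrite mulr_ge0// divr_ge0// ltW.
- move=> B mB; have mB' : measurable (@feature _ X @^-1` B).
    by rewrite -[X in measurable X]setTI; exact: measurable_feature.
  under eq_integral do rewrite EFinM.
  rewrite integralZl//; last exact: integrableS ig.
  have gE : (\int[lawX_A P a]_(x in B) (g x)%:E =
      P (@feature _ X @^-1` B `&` (ev_A a `&` ev_Y y)) * (pA P a)^-1%:E)%E.
    have mI := measurable_ev_AY; have mA := measurable_ev_A.
    have eta1 : (\int[lawX_A P a]_(x in B) (eta a x)%:E =
        P (@feature _ X @^-1` B `&` (ev_A a `&` ev_Y true)) * (pA P a)^-1%:E)%E.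
      by rewrite -etaE// conditionedE// -setIA [ev_Y _ `&` _]setIC.
    rewrite /g; case: (y) => //.
    (* For label [false], the integral of [1 - eta a] is the mass of [B] minus the part with label
       [true]. *)
    rewrite integralB_EFin//; last 2 first.
    - apply: (@integrableS _ _ _ _ setT) => //.
      by apply: (@bounded_integrable _ _ _ _ _ 1) => // x; rewrite normr1.
    - apply: (@integrableS _ _ _ _ setT) => //.
      apply: (@bounded_integrable _ _ _ _ _ 1) => // x.
      by have /andP[? ?] := eta01 x; rewrite ger0_norm.
    rewrite eta1 integral_cst// mul1e.
    rewrite {1}/lawX_A /= /distribution /pushforward /= conditionedE//.
    rewrite -/(pA P a).
    have mBY b : measurable (@feature _ X @^-1` B `&` (ev_A a `&` ev_Y b)).
      by apply: measurableI.
    have -> : P (@feature _ X @^-1` B `&` ev_A a) =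
        (P (@feature _ X @^-1` B `&` (ev_A a `&` ev_Y true)) +
         P (@feature _ X @^-1` B `&` (ev_A a `&` ev_Y false)))%E.
      rewrite -measureU//; last first.
        apply/seteqP; split => // z [[_ [_ yt]] [_ [_ yf]]].
        by have := etrans (esym yt) yf.
      rewrite -!setIUr (_ : ev_Y true `|` ev_Y false = setT) ?setIT//.
      by apply/seteqP; split => // -[? []] _; [left|right].
    have fP b : P (@feature _ X @^-1` B `&` (ev_A a `&` ev_Y b)) =
        (fine (P (@feature _ X @^-1` B `&` (ev_A a `&` ev_Y b))))%:E.
      by rewrite fineK ?fin_num_measure.
    rewrite (fP true) (fP false).
    have subK (u v c : R) :
        ((u%:E + v%:E) * c%:E - u%:E * c%:E = v%:E * c%:E)%E.
      rewrite -(EFinD u) -(EFinM (u + v)) -(EFinM u) -(EFinM v) -EFinB.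
      by congr EFin; ring.
    exact: subK.
  rewrite gE muleCA -EFinM.
  rewrite {1}/lawX_AY /= /distribution /pushforward /= conditionedE//.
  by congr (_ * _%:E)%E; rewrite -/(pAY P a y); field; rewrite !gt_eqF.
- by move=> x; have /andP[] := h01 x.
Qed.

End regression.
End feature_law.

(** * Tails of atomless random variables *)

Section tails.
Context d (T : measurableType d) (R : realType) (mu : probability T R).
Variable f : {mfun T >-> R}.

Definition tail (c : R) : R := \int[mu]_x (c < f x)%R%:R.

Lemma measurable_gt_indicator (c : R) :
  measurable_fun setT (fun x => (c < f x)%R%:R : R).
Proof.
rewrite (_ : (fun x => _) = (fun x => if c < f x then 1 else 0)).
  by apply: measurable_fun_ifT => //; exact: measurable_fun_ltr.
by apply/funext => x; case: ifPn.
Qed.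

Lemma gt_indicator01 (c : R) x : 0 <= ((c < f x)%R%:R : R) <= 1.
Proof. by case: (_ < _); rewrite lexx ler01. Qed.

Lemma integrable_gt_indicator c : mu.-integrable setT (fun x => ((c < f x)%R%:R : R)%:E).
Proof.
apply: (@bounded_integrable _ _ _ _ _ 1); first exact: measurable_gt_indicator.
by move=> x; case: (_ < _); rewrite ?normr1 ?normr0.
Qed.

Lemma tail_nonincreasing c c' : c <= c' -> tail c' <= tail c.
Proof.
move=> cc'; apply: le_Rintegral => //; [exact: integrable_gt_indicator..|move=> x _].
by rewrite ler_nat; case: (ltP c' (f x)) => // /(le_lt_trans cc') ->.
Qed.

Lemma tail_ge0 c : 0 <= tail c.
Proof. by apply: Rintegral_ge0. Qed.

Lemma Rintegral1 : \int[mu]_x 1 = 1 :> R.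
Proof.
by rewrite Rintegral_cst// mul1r; exact: (congr1 fine (probability_setT mu)).
Qed.

Lemma tail_le1 c : tail c <= 1.
Proof.
rewrite -[leRHS]Rintegral1; apply: le_Rintegral => //; first exact: integrable_gt_indicator.
  by apply: (@bounded_integrable _ _ _ _ _ 1) => // x; rewrite normr1.
by move=> x _; have /andP[] := gt_indicator01 c x.
Qed.

Lemma tail_eq0 c : (forall x, f x <= c) -> tail c = 0.
Proof.
move=> fc; rewrite /tail (@eq_Rintegral _ _ _ mu setT (cst 0)) => [|x _]; last by rewrite ltNge fc.
by rewrite Rintegral_cst// mul0r.
Qed.

Hypothesis atomless : forall c, mu (f @^-1` [set c]) = 0.

Lemma ae_neq c : {ae mu, forall x, f x != c}.
Proof.
exists (f @^-1` [set c]); split; [|exact: atomless|].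
  by rewrite -[X in measurable X]setTI; exact: measurable_funPT.
by move=> x /= /negP; rewrite negbK => /eqP.
Qed.

(** The inequality in [tail] is strict, so the level set of [c] is lost; it is null. *)
Lemma tail_eq1 c : (forall x, c <= f x) -> tail c = 1.
Proof.
move=> cf; rewrite -[RHS]Rintegral1 /tail /Rintegral; congr fine; apply: ae_eq_integral => //.
  exact/measurable_EFinP/measurable_gt_indicator.
apply: filterS (ae_neq c) => x fxc _ /=.
by rewrite lt_neqAle eq_sym fxc cf.
Qed.

(** Along a sequence tending to [c], the indicators are eventually constant at each point where
    [f x != c], that is, almost everywhere; dominated convergence concludes. *)
Lemma tail_continuous : continuous tail.
Proof.
move=> c; apply/(@cvg_nbhsP _ R^o) => u uc.
rewrite /tail /Rintegral; apply: fine_cvg.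
rewrite fineK; last exact: integrable_fin_num (integrable_gt_indicator c).
have [] // := @dominated_convergence _ _ _ mu setT measurableT
  (fun n x => ((u n < f x)%R%:R : R)%:E) (fun x => ((c < f x)%R%:R : R)%:E)
  (cst 1%E).
- by move=> n; exact/measurable_EFinP/measurable_gt_indicator.
- exact/measurable_EFinP/measurable_gt_indicator.
- apply: filterS (ae_neq c) => x; rewrite neq_lt => /orP[fc|cf] _.
    rewrite (ltNge c) (ltW fc) /=; apply: cvg_near_cst.
    near=> n; rewrite ltNge ltW//.
    by near: n; exact: (cvgr_gt c).
  rewrite cf; apply: cvg_near_cst; near=> n; suff -> : u n < f x by [].
  by near: n; exact: (cvgr_lt c).
- by apply: (@bounded_integrable _ _ _ _ (cst 1) 1) => // x; rewrite normr1.
- by apply: aeW => x n _ /=; rewrite lee_fin; case: (_ < _); rewrite ?normr1 ?normr0.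
Unshelve. all: by end_near. Qed.

End tails.

(** * Threshold rules for a weighted disparity *)

Section weighted_disparity.
Context d (X : measurableType d) (R : realType).
Variable P : probability (X * bool * bool)%type R.
Variable eta : bool -> {mfun X >-> R}.
Hypothesis heta : is_regression_function P eta.
Hypothesis hp : forall a y, 0 < pAY P a y.
Hypothesis hpdf : forall a, has_pdf (distribution (lawX_A P a) (eta a)).

Let eta01 a x : 0 <= eta a x <= 1.
Proof. by have [] := heta a. Qed.

Let mu_atomless a c : lawX_A P a (eta a @^-1` [set c]) = 0%E.
Proof.
have [g [_ _ gE]] := hpdf a.
by have := gE [set c] (measurable_set1 c); rewrite integral_set1.
Qed.

(** In each group, the densities from Bayes' rule merge the two label terms, their factor
    [pA P a / pAY P a y] cancelling the weight [pAY P a y]. *)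
Lemma riskE_eta (f : classifier X R) :
  risk P f = \sum_(a : bool) pA P a *
    \int[lawX_A P a]_x ((1 - f (x, a)) * eta a x + f (x, a) * (1 - eta a x)).
Proof.
rewrite riskE//; apply: eq_bigr => a _.
have mf := measurable_classifier_group f a.
have f01 x : 0 <= f (x, a) <= 1 := classifier_group01 f a x.
have mNf : measurable_fun setT (fun x => 1 - f (x, a)) by exact: measurable_funB.
have Nf01 x : 0 <= 1 - f (x, a) <= 1.
  by have /andP[? ?] := f01 x; apply/andP; split; lra.
have p0 := pA_gt0 hp a; have q0 := hp a.
have int1 : (lawX_A P a).-integrable setT
    (EFin \o (fun x => (1 - f (x, a)) * eta a x)).
  apply: (@bounded_integrable _ _ _ _ _ 1) => [|x]; first exact: measurable_funM.
  have /andP[? ?] := Nf01 x; have /andP[? ?] := eta01 a x.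
  by rewrite ger0_norm ?mulr_ge0// mulr_ile1.
have int2 : (lawX_A P a).-integrable setT
    (EFin \o (fun x => f (x, a) * (1 - eta a x))).
  apply: (@bounded_integrable _ _ _ _ _ 1) => [|x].
    by apply: measurable_funM => //; exact: measurable_funB.
  have /andP[? ?] := f01 x; have /andP[? ?] := eta01 a x.
  by rewrite ger0_norm ?mulr_ge0 ?mulr_ile1//; lra.
rewrite big_bool /= !(lawX_AY_density heta hp)// RintegralD// mulrDr.
congr (_ + _).
- under eq_Rintegral do rewrite mulrCA.
  by rewrite RintegralZl// mulrA mulrCA mulfV ?mulr1 ?gt_eqF.
- under eq_Rintegral do rewrite mulrCA.
  by rewrite RintegralZl// mulrA mulrCA mulfV ?mulr1 ?gt_eqF.
Qed.

(* [nu a] stands for the law of [X] given [A = a] (DD), given [A = a, Y = 1] (DO)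
   or given [A = a, Y = 0] (PD); [w a (eta a x)] is its density with respect to
   the law of [X] given [A = a]. *)
Variables (nu : bool -> probability X R) (w : bool -> R -> R) (M : bool -> R).
Hypothesis mw : forall a, measurable_fun setT (fun x => w a (eta a x)).
Hypothesis w_ge0 : forall a x, 0 <= w a (eta a x) <= M a.
Hypothesis nuE : forall a (h : X -> R),
  measurable_fun setT h -> (forall x, 0 <= h x <= 1) ->
  \int[nu a]_x h x = \int[lawX_A P a]_x (h x * w a (eta a x)).

(** [nu a] inherits the absence of atoms through its density with respect to [lawX_A P a]. *)
Let nu_atomless a c : nu a (eta a @^-1` [set c]) = 0%E.
Proof.
set B := _ @^-1` _.
have mB : measurable B.
  by rewrite -[X in measurable X]setTI; exact: measurable_funPT.
suff nu0 : fine (nu a B) = 0.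
  by apply/eqP; rewrite -fine_eq0 ?fin_num_measure// nu0.
have -> : fine (nu a B) = \int[nu a]_x \1_B x.
  by rewrite /Rintegral integral_indic// setIT.
rewrite nuE//; last by move=> x; rewrite indicE; case: (_ \in _); rewrite lexx ler01.
have -> : 0 = \int[lawX_A P a]_x (0 : R) by rewrite Rintegral_cst// mul0r.
rewrite /Rintegral; congr fine; apply: ae_eq_integral => //.
  by apply/measurable_EFinP/measurable_funM.
apply: filterS (ae_neq (mu_atomless a) c) => x /eqP xc _ /=.
by rewrite indicE memNset// mul0r.
Qed.

(** The contribution of group [a] to the Lagrangian [risk P f + t * Dis f]. *)
Let group_lagrangian (t : R) (a : bool) (f : X -> R) :=
  pA P a * \int[lawX_A P a]_x ((1 - f x) * eta a x + f x * (1 - eta a x)) +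
  t * (sgnA R a * \int[nu a]_x f x).

(** The integrand is affine in the value of the rule, which ranges over [0, 1]. The hypotheses on
    [c] say that its slope is nonpositive above the threshold and nonnegative below, so the
    indicator minimizes it at each point. *)
Let group_lagrangian_min t a c (f : X -> R) :
  measurable_fun setT f -> (forall x, 0 <= f x <= 1) ->
  (forall x, c < eta a x ->
    pA P a * (1 - 2 * eta a x) + t * sgnA R a * w a (eta a x) <= 0) ->
  (forall x, eta a x <= c ->
    0 <= pA P a * (1 - 2 * eta a x) + t * sgnA R a * w a (eta a x)) ->
  group_lagrangian t a (fun x => (c < eta a x)%R%:R) <= group_lagrangian t a f.
Proof.
move=> mf f01 gtc lec.
pose l (h : X -> R) x := pA P a * ((1 - h x) * eta a x + h x * (1 - eta a x)) +
  t * (sgnA R a * (h x * w a (eta a x))).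
have intl (h : X -> R) : measurable_fun setT h -> (forall x, 0 <= h x <= 1) ->
    group_lagrangian t a h = \int[lawX_A P a]_x l h x /\
    (lawX_A P a).-integrable setT (EFin \o l h).
  move=> mh h01.
  have i1 : (lawX_A P a).-integrable setT
      (EFin \o (fun x => (1 - h x) * eta a x + h x * (1 - eta a x))).
    apply: (@bounded_integrable _ _ _ _ _ 1) => [|x].
      by apply: measurable_funD; apply: measurable_funM => //; exact: measurable_funB.
    have /andP[? ?] := h01 x; have /andP[? ?] := eta01 a x.
    by rewrite ger0_norm; nra.
  have i2 : (lawX_A P a).-integrable setT (EFin \o (fun x => h x * w a (eta a x))).
    apply: (@bounded_integrable _ _ _ _ _ (M a)) => [|x]; first exact: measurable_funM.
    have /andP[? ?] := h01 x; have /andP[? ?] := w_ge0 a x.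
    rewrite ger0_norm ?mulr_ge0//.
    by apply: le_trans (_ : w a (eta a x) <= M a) => //; rewrite ler_piMl.
  have iZ k (g : X -> R) : (lawX_A P a).-integrable setT (EFin \o g) ->
      (lawX_A P a).-integrable setT (EFin \o (fun x => k * g x)).
    by move=> ig; have := integrableZl measurableT k ig.
  have i3 := iZ (sgnA R a) _ i2.
  have i4 := iZ t _ i3; have i5 := iZ (pA P a) _ i1.
  rewrite /group_lagrangian nuE// -!RintegralZl// -RintegralD//; split=> //.
  by have := integrableD measurableT i5 i4.
have [-> i1] := intl _ (measurable_gt_indicator (eta a) c) (gt_indicator01 (eta a) c).
have [-> i2] := intl _ mf f01.
apply: le_Rintegral => // x _; rewrite /l.
have /andP[f0 f1] := f01 x.
case: ltP => [/gtc|/lec] H /=; rewrite ?mulr1n ?mulr0n.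
(* This product is exactly the gap between the two integrands; in the other case the gap is [f x]
   times the slope. *)
- have : 0 <= (1 - f x) * - (pA P a * (1 - 2 * eta a x) + t * sgnA R a * w a (eta a x)).
    by rewrite mulr_ge0//; lra.
  lra.
- have := mulr_ge0 f0 H; lra.
Qed.

Variables (thr : R -> bool -> R) (lo hi : R).
Hypothesis lo0hi : lo <= 0 <= hi.
Hypothesis thr_continuous : forall a, {in `[lo, hi], continuous (thr ^~ a)}.
(** The sign makes the threshold of group [true] rise and that of group [false] fall, so that both
    changes push the disparity down. *)
Hypothesis thr_monotone : forall a, {in `[lo, hi] &, forall s t, s <= t ->
  sgnA R a * thr s a <= sgnA R a * thr t a}.
(** At the right end, group [true] is wholly rejected or group [false] wholly accepted, up to a null
    set; either one makes the disparity nonpositive. The left end is symmetric. *)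
Hypothesis thr_hi : 1 <= thr hi true \/ thr hi false <= 0.
Hypothesis thr_lo : thr lo true <= 0 \/ 1 <= thr lo false.
(* The right-hand side is the coefficient of [f (x, a)] in the integrand of
   [risk f + t * Dis f] at a point where [eta a x = e]. *)
Hypothesis thrE : forall t a e, t \in `[lo, hi] ->
  (thr t a < e) = (pA P a * (1 - 2 * e) + t * sgnA R a * w a e < 0).

Lemma fair_bayes_optimal_threshold (Dis : classifier X R -> R) (delta : R) :
  0 < delta ->
  (forall f, Dis f =
    \int[nu true]_x f (x, true) - \int[nu false]_x f (x, false)) ->
  exists t0 : R,
    argmin [set t | t \in `[lo, hi] /\
              `| \sum_(a : bool) sgnA R a *
                   \int[nu a]_x (thr t a < eta a x)%R%:R | <= delta]
      (fun t => `|t|) = [set t0] /\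
    fair_bayes_optimal P Dis delta (threshold_rule eta (thr t0)).
Proof.
move=> delta0 DisE.
pose G a := tail (nu a) (eta a).
pose D t := G true (thr t true) - G false (thr t false).
have sgnT : sgnA R true = 1 by rewrite /sgnA /=; ring.
have sgnF : sgnA R false = -1 by rewrite /sgnA /=; ring.
have sumE t : \sum_(a : bool) sgnA R a *
    \int[nu a]_x (thr t a < eta a x)%R%:R = D t.
  by rewrite big_bool /= sgnT sgnF mul1r mulN1r.
have cG a : continuous (G a) := tail_continuous (nu_atomless a).
have G0 a c : 1 <= c -> G a c = 0.
  by move=> c1; apply: tail_eq0 => x; have /andP[_] := eta01 a x; move/le_trans; apply.
have G1 a c : c <= 0 -> G a c = 1.
  move=> c0; apply: tail_eq1; first exact: nu_atomless.
  by move=> x; have /andP[/(le_trans c0)] := eta01 a x.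
have G_ge0 a c : 0 <= G a c := tail_ge0 _ _ c.
have G_le1 a c : G a c <= 1 := tail_le1 _ _ c.
have [|||t0 argminE slack] := @argmin_norm_slackness _ D lo hi delta lo0hi delta0.
- apply: continuous_in_subspaceT => t tI; rewrite inE in tI.
  by apply: cvgB; apply: continuous_comp (cG _ _); exact: thr_continuous.
- move=> s t sI tI st; apply: lerB; apply: tail_nonincreasing.
    by have := thr_monotone true sI tI st; rewrite sgnT !mul1r.
  by have := thr_monotone false sI tI st; rewrite sgnF !mulN1r lerN2.
- apply/andP; split; rewrite /D ?subr_le0 ?subr_ge0.
    by case: thr_hi => [/(G0 true) ->|/(G1 false) ->].
  by case: thr_lo => [/(G1 true) ->|/(G0 false) ->].
have [[t0I Dt0] _] : argmin [set t | t \in `[lo, hi] /\ `|D t| <= delta]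
    (fun t => `|t|) t0 by rewrite argminE.
exists t0; split.
  rewrite -argminE; congr (argmin _ _).
  by apply/seteqP; split => t /=; rewrite sumE.
have DisT : Dis (threshold_rule eta (thr t0)) = D t0 by rewrite DisE.
split=> [|f /= Df]; first by rewrite /= DisT.
have lagrE g : risk P g + t0 * Dis g =
    \sum_(a : bool) group_lagrangian t0 a (fun x => g (x, a)).
  rewrite riskE_eta DisE !big_bool /group_lagrangian /= sgnT sgnF; ring.
have lagr_min : risk P (threshold_rule eta (thr t0)) +
    t0 * Dis (threshold_rule eta (thr t0)) <= risk P f + t0 * Dis f.
  rewrite (lagrE (threshold_rule _ _)) (lagrE f).
  apply: ler_sum => a _.
  apply: (@group_lagrangian_min t0 a (thr t0 a) (fun x => f (x, a))).
  - exact: measurable_classifier_group.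
  - exact: classifier_group01.
  - by move=> x; rewrite thrE// => /ltW.
  - by move=> x; rewrite leNgt thrE// -leNgt.
(* Slackness turns the penalty of the threshold rule into [|t0| * delta], an upper bound for the
   penalty of any fair [f]; the two then cancel. *)
rewrite DisT slack in lagr_min.
rewrite -(lerD2r (`|t0| * delta)); apply: le_trans lagr_min _; rewrite lerD2l.
by rewrite (le_trans (ler_norm _))// normrM ler_wpM2l.
Qed.

End weighted_disparity.

(** * The three families of thresholds *)

Section thresholds.
Context d (X : measurableType d) (R : realType).
Variable P : probability (X * bool * bool)%type R.
Hypothesis hp : forall a y, 0 < pAY P a y.

Let p_gt0 a : 0 < pA P a. Proof. exact: pA_gt0. Qed.

Lemma thresholdDD_continuous a : continuous (thresholdDD P ^~ a).
Proof.
move=> t; apply: cvgD; first exact: cvg_cst.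
by apply: cvgM; [apply: cvgM => //; exact: cvg_cst|exact: cvg_cst].
Qed.

(** The ends of the interval are chosen so that the denominator stays at least [pAY P a true]. *)
Lemma thresholdDO_denominator_gt0 t a :
  t \in `[- pAY P false true, pAY P true true] ->
  0 < 2 * pAY P a true - sgnA R a * t.
Proof.
have := hp true true; have := hp false true.
by rewrite in_itv/= /sgnA => ? ? /andP[? ?]; case: a => /=; lra.
Qed.

Lemma thresholdPD_denominator_gt0 t a :
  t \in `[- pAY P true false, pAY P false false] ->
  0 < 2 * pAY P a false + sgnA R a * t.
Proof.
have := hp true false; have := hp false false.
by rewrite in_itv/= /sgnA => ? ? /andP[? ?]; case: a => /=; lra.
Qed.

Lemma thresholdDO_continuous a :
  {in `[- pAY P false true, pAY P true true],
    continuous (thresholdDO P ^~ a)}.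
Proof.
move=> t tI; apply: cvgM; first exact: cvg_cst.
apply: cvgV; first by rewrite gt_eqF// thresholdDO_denominator_gt0.
by apply: cvgB; [exact: cvg_cst|apply: cvgM => //; exact: cvg_cst].
Qed.

Lemma thresholdPD_continuous a :
  {in `[- pAY P true false, pAY P false false],
    continuous (thresholdPD P ^~ a)}.
Proof.
move=> t tI; apply: cvgM.
  by apply: cvgD; [exact: cvg_cst|apply: cvgM => //; exact: cvg_cst].
apply: cvgV; first by rewrite gt_eqF// thresholdPD_denominator_gt0.
by apply: cvgD; [exact: cvg_cst|apply: cvgM => //; exact: cvg_cst].
Qed.

Lemma sgnA_sqr a : sgnA R a * sgnA R a = 1.
Proof. by rewrite /sgnA; case: a => /=; ring. Qed.

Lemma thresholdDD_monotone a s t : s <= t ->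
  sgnA R a * thresholdDD P s a <= sgnA R a * thresholdDD P t a.
Proof.
move=> st; rewrite /thresholdDD !mulrDr lerD2l !mulrA sgnA_sqr !mul1r.
by rewrite ler_pM2r// invr_gt0 mulr_gt0.
Qed.

(** After cross-multiplication the sign occurs only squared, which treats both groups at once. *)
Lemma thresholdDO_monotone a :
  {in `[- pAY P false true, pAY P true true] &, forall s t, s <= t ->
    sgnA R a * thresholdDO P s a <= sgnA R a * thresholdDO P t a}.
Proof.
move=> s t sI tI st; rewrite /thresholdDO !mulrA.
have ds := thresholdDO_denominator_gt0 a sI.
have dt := thresholdDO_denominator_gt0 a tI.
rewrite ler_pdivrMr// mulrAC ler_pdivlMr// -subr_ge0.
have -> : sgnA R a * pAY P a true * (2 * pAY P a true - sgnA R a * s) -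
    sgnA R a * pAY P a true * (2 * pAY P a true - sgnA R a * t) =
    pAY P a true * (t - s) * (sgnA R a * sgnA R a) by ring.
by rewrite sgnA_sqr mulr1 mulr_ge0 ?subr_ge0// ltW.
Qed.

Lemma thresholdPD_monotone a :
  {in `[- pAY P true false, pAY P false false] &, forall s t, s <= t ->
    sgnA R a * thresholdPD P s a <= sgnA R a * thresholdPD P t a}.
Proof.
move=> s t sI tI st; rewrite /thresholdPD !mulrA.
have ds := thresholdPD_denominator_gt0 a sI.
have dt := thresholdPD_denominator_gt0 a tI.
rewrite ler_pdivrMr// mulrAC ler_pdivlMr// -subr_ge0.
have -> : sgnA R a * (pAY P a false + sgnA R a * t) *
      (2 * pAY P a false + sgnA R a * s) -
    sgnA R a * (pAY P a false + sgnA R a * s) *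
      (2 * pAY P a false + sgnA R a * t) =
    pAY P a false * (t - s) * (sgnA R a * sgnA R a) by ring.
by rewrite sgnA_sqr mulr1 mulr_ge0 ?subr_ge0// ltW.
Qed.

Lemma thresholdDD_lt t a e :
  (thresholdDD P t a < e) = (pA P a * (1 - 2 * e) + t * sgnA R a * 1 < 0).
Proof.
have p2 : 0 < 2 * pA P a by rewrite mulr_gt0.
rewrite -subr_lt0 -(pmulr_rlt0 _ p2) /thresholdDD; congr (_ < _).
by field; rewrite gt_eqF.
Qed.

Lemma thresholdDO_lt t a e :
  t \in `[- pAY P false true, pAY P true true] ->
  (thresholdDO P t a < e) =
  (pA P a * (1 - 2 * e) + t * sgnA R a * (pA P a / pAY P a true * e) < 0).
Proof.
move=> tI; rewrite /thresholdDO ltr_pdivrMr ?thresholdDO_denominator_gt0//.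
(* Once the denominator is cleared, the two sides differ by this positive factor. *)
have pq : 0 < pA P a / pAY P a true by rewrite divr_gt0.
rewrite -subr_lt0 -(pmulr_rlt0 _ pq); congr (_ < _).
by field; rewrite gt_eqF.
Qed.

Lemma thresholdPD_lt t a e :
  t \in `[- pAY P true false, pAY P false false] ->
  (thresholdPD P t a < e) =
  (pA P a * (1 - 2 * e) +
   t * sgnA R a * (pA P a / pAY P a false * (1 - e)) < 0).
Proof.
move=> tI; rewrite /thresholdPD ltr_pdivrMr ?thresholdPD_denominator_gt0//.
have pq : 0 < pA P a / pAY P a false by rewrite divr_gt0.
rewrite -subr_lt0 -(pmulr_rlt0 _ pq); congr (_ < _).
by field; rewrite gt_eqF.
Qed.

Lemma thresholdDD_eq1 a : thresholdDD P (sgnA R a * pA P a) a = 1.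
Proof.
rewrite /thresholdDD mulrA sgnA_sqr.
by field; rewrite gt_eqF.
Qed.

Lemma thresholdDD_eq0 a : thresholdDD P (- (sgnA R a * pA P a)) a = 0.
Proof.
rewrite /thresholdDD mulrN mulrA sgnA_sqr.
by field; rewrite gt_eqF.
Qed.

Lemma thresholdDO_eq1 a : thresholdDO P (sgnA R a * pAY P a true) a = 1.
Proof.
rewrite /thresholdDO mulrA sgnA_sqr.
by rewrite mul1r mulr_natl mulr2n addrK divff ?gt_eqF.
Qed.

Lemma thresholdPD_eq0 a : thresholdPD P (- (sgnA R a * pAY P a false)) a = 0.
Proof. by rewrite /thresholdPD mulrN mulrA sgnA_sqr mul1r subrr mul0r. Qed.

End thresholds.

(** * The three disparities as instances *)

Unset Implicit Arguments.

Theorem corollary4p3 (d : measure_display) (X : measurableType d)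
    (R : realType) (P : probability (X * bool * bool)%type R)
    (eta : bool -> {mfun X >-> R}) (delta : R)
    (hp : forall a y : bool, 0 < pAY P a y)
    (heta : is_regression_function P eta)
    (hpdf : forall a : bool, has_pdf (distribution (lawX_A P a) (eta a)))
    (hdelta : 0 < delta) :
  [/\ exists tDD : R,
        argmin [set t | t \in `[- Num.min (pA P true) (pA P false),
                                Num.min (pA P true) (pA P false)] /\
                  `| \sum_(a : bool) sgnA R a *
                       \int[lawX_A P a]_x (thresholdDD P t a < eta a x)%R%:R |
                    <= delta]
          (fun t => `|t|) = [set tDD] /\
        fair_bayes_optimal P (DD P) delta
          (threshold_rule eta (thresholdDD P tDD)),
      exists tDO : R,
        argmin [set t | t \in `[- pAY P false true, pAY P true true] /\
                  `| \sum_(a : bool) sgnA R a *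
                       \int[lawX_AY P a true]_x
                         (thresholdDO P t a < eta a x)%R%:R |
                    <= delta]
          (fun t => `|t|) = [set tDO] /\
        fair_bayes_optimal P (DO P) delta
          (threshold_rule eta (thresholdDO P tDO)) &
      exists tPD : R,
        argmin [set t | t \in `[- pAY P true false, pAY P false false] /\
                  `| \sum_(a : bool) sgnA R a *
                       \int[lawX_AY P a false]_x
                         (thresholdPD P t a < eta a x)%R%:R |
                    <= delta]
          (fun t => `|t|) = [set tPD] /\
        fair_bayes_optimal P (PD P) delta
          (threshold_rule eta (thresholdPD P tPD))].
Proof.
have p0 := pA_gt0 hp.
have eta01 a x : 0 <= eta a x <= 1 by have [] := heta a.
have sgnT : sgnA R true = 1 by rewrite /sgnA /=; ring.
have sgnF : sgnA R false = -1 by rewrite /sgnA /=; ring.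
have q0 a y : 0 <= pA P a / pAY P a y by rewrite divr_ge0// ltW.
have AY_A a y : ev_A a `&` ev_Y y `<=` @ev_A _ X a by exact: subIsetl.
split.
- apply: (@fair_bayes_optimal_threshold _ _ _ P eta heta hp hpdf (lawX_A P)
    (fun _ _ => 1) (fun=> 1)) => //.
  + by move=> a x; rewrite ler01 lexx.
  + by move=> a h _ _; under [RHS]eq_Rintegral do rewrite mulr1.
  + by rewrite oppr_le0 le_min !ltW.
  + by move=> a t _; exact: thresholdDD_continuous.
  + by move=> a s t _ _; exact: thresholdDD_monotone.
  + have := thresholdDD_eq1 hp true; have := thresholdDD_eq0 hp false.
    rewrite sgnT sgnF mul1r mulN1r opprK => e0 e1.
    (* The smaller group saturates first: group [true] reaches threshold 1, or group [false] reaches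
       threshold 0. *)
    by case: (leP (pA P true)) => _; [left; rewrite e1|right; rewrite e0].
  + have := thresholdDD_eq0 hp true; have := thresholdDD_eq1 hp false.
    rewrite sgnT sgnF mul1r mulN1r => e1 e0.
    by case: (leP (pA P true)) => _; [left; rewrite e0|right; rewrite e1].
  + by move=> t a e _; exact: thresholdDD_lt.
  + move=> f; have rateE a := positive_rateE f (measurable_ev_A a) (p0 a)
      (@subset_refl _ _).
    by rewrite /DD !rateE.
(* The weight is the Bayes density of the law given label [true], with [e] standing for
   [eta a x]. *)
- apply: (@fair_bayes_optimal_threshold _ _ _ P eta heta hp hpdf
    (fun a => lawX_AY P a true) (fun a e => pA P a / pAY P a true * e)
    (fun a => pA P a / pAY P a true)) => //.
  + by move=> a; exact: measurable_funM.
  + by move=> a x; have /andP[? ?] := eta01 a x; rewrite mulr_ge0// ler_piMr.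
  + by move=> a h mh h01; rewrite (lawX_AY_density heta hp).
  + by rewrite oppr_le0 !ltW.
  + by move=> a; exact: thresholdDO_continuous.
  + by move=> a; exact: thresholdDO_monotone.
  + by left; have := thresholdDO_eq1 hp true; rewrite sgnT mul1r => ->.
  + by right; have := thresholdDO_eq1 hp false; rewrite sgnF mulN1r => ->.
  + by move=> t a e tI; exact: thresholdDO_lt.
  + move=> f; have rateE a := positive_rateE f (measurable_ev_AY a true)
      (hp a true) (AY_A a true).
    by rewrite /DO !rateE.
- apply: (@fair_bayes_optimal_threshold _ _ _ P eta heta hp hpdf
    (fun a => lawX_AY P a false) (fun a e => pA P a / pAY P a false * (1 - e))
    (fun a => pA P a / pAY P a false)) => //.
  + by move=> a; apply: measurable_funM => //; exact: measurable_funB.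
  + move=> a x; have /andP[? ?] := eta01 a x.
    by rewrite mulr_ge0 ?ler_piMr//; lra.
  + by move=> a h mh h01; rewrite (lawX_AY_density heta hp).
  + by rewrite oppr_le0 !ltW.
  + by move=> a; exact: thresholdPD_continuous.
  + by move=> a; exact: thresholdPD_monotone.
  (* Here saturation means full acceptance: of group [false] at the right end, of group [true] at
     the left end. *)
  + by right; have := thresholdPD_eq0 P false; rewrite sgnF mulN1r opprK => ->.
  + by left; have := thresholdPD_eq0 P true; rewrite sgnT mul1r => ->.
  + by move=> t a e tI; exact: thresholdPD_lt.
  + move=> f; have rateE a := positive_rateE f (measurable_ev_AY a false)
      (hp a false) (AY_A a false).
    by rewrite /PD !rateE.
Qed.
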